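(* Let $n\ge2$. As subsets of $\mathcal{S}(\mathbb{R}^n;S^2)$, the kernels of the transforms $\{I^0,I^1\}$ and $X^1$ are equal. That is, for $f\in\mathcal{S}(\mathbb{R}^n;S^2)$ one has $I^0f=0$ and $I^1f=0$ if and only if $X^1f=0$.
   Context: $\mathcal{S}(\mathbb{R}^n;S^2)$ is the space of symmetric $2$-tensor fields $f=(f_{ij})$ on $\mathbb{R}^n$ with Schwartz components; elastic $1$-tensor fields, i.e. fields with values in $E^1(n)=S^2(\mathbb{R}^n)$, are identified with symmetric $2$-tensor fields. $T\mathbb{S}^{n-1}=\{(x,\xi)\in\mathbb{R}^n\times\mathbb{S}^{n-1}:\langle x,\xi\rangle=0\}$. For an integer $q\ge0$, the $q$-th integral moment transform is $$I^qf(x,\xi)=\sum_{i,j=1}^n\int_{-\infty}^\infty t^qf_{ij}(x+t\xi)\,\xi_i\xi_j\,dt,\qquad (x,\xi)\in T\mathbb{S}^{n-1}.$$ Let $\mathcal{Z}=\{(\xi,\zeta):\xi\in\mathbb{S}^{n-1},\ \zeta\in\mathbb{R}\xi\cup\xi^\perp\}$, where $\xi^\perp$ is the hyperplane through the origin orthogonal to $\xi$. The elastic ray transform $X^1$ is $$X^1f(x,\xi,\zeta)=\sum_{i,j=1}^n\int_{\mathbb{R}}f_{ij}(x+t\xi)\,\xi_i\zeta_j\,dt,\qquad (x,\xi,\zeta)\in\mathbb{R}^n\times\mathcal{Z}.$$ *)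

(* Defs.v *)
(* MathComp-Analysis, over an arbitrary [R : realType]. *)
From HB Require Import structures.
From mathcomp Require Import all_boot all_order all_algebra.
From mathcomp Require Import all_classical all_reals all_analysis.
Import Order.TTheory GRing.Theory Num.Theory.
Import numFieldNormedType.Exports.

Set Implicit Arguments.
Unset Strict Implicit.
Unset Printing Implicit Defensive.

Local Open Scope classical_set_scope.
Local Open Scope ring_scope.

Section Defs.
Context {R : realType} {n : nat}.
Implicit Types (x y xi zeta : 'rV[R]_n) (g : 'rV[R]_n -> R)
  (f : 'rV[R]_n -> 'M[R]_n).

(* The norm [`|x|] on ['rV[R]_n] is the sup norm, so Euclidean notions are
   expressed through [dot]. *)
Definition dot x y : R := \sum_(i < n) x 0 i * y 0 i.

Definition usphere : set 'rV[R]_n := [set xi | dot xi xi = 1].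

Definition TS : set ('rV[R]_n * 'rV[R]_n) :=
  [set p | usphere p.2 /\ dot p.1 p.2 = 0].

Definition ZZ : set ('rV[R]_n * 'rV[R]_n) :=
  [set p | usphere p.1 /\
    ((exists c : R, p.2 = c *: p.1) \/ dot p.2 p.1 = 0)].

(* [partials [:: i1; ...; ik] g] is d_i1 (... (d_ik g)). Lists of coordinates
   are used in place of multi-indices; the order of differentiation is
   irrelevant for smooth functions. *)
Definition partials (s : seq 'I_n) g : 'rV[R]_n -> R :=
  foldr (fun i h x => 'D_(delta_mx 0 i) h x) g s.

Definition monom (a : 'I_n -> nat) x : R := \prod_(i < n) x 0 i ^+ a i.

(* The explicit differentiability clause is needed because ['D_v g x] is a
   total operator with a junk value where the derivative does not exist. *)
Definition schwartz g : Prop :=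
  (forall s x, differentiable (partials s g) x) /\
  (forall a s, exists C : R, forall x, `|monom a x * partials s g x| <= C).

Definition schwartz_sym2 f : Prop :=
  (forall x, (f x)^T = f x) /\ (forall i j, schwartz (fun x => f x i j)).

(* [Rintegral] is the real-valued Lebesgue integral, equal to 0 by convention
   when the integral is infinite; all the integrands below are integrable when
   [f] is Schwartz and [xi] is a unit vector. *)
Definition moment (q : nat) f x xi : R :=
  \sum_(i < n) \sum_(j < n)
    \int[lebesgue_measure]_t (t ^+ q * f (x + t *: xi) i j * xi 0 i * xi 0 j).

Definition elastic_ray1 f x xi zeta : R :=
  \sum_(i < n) \sum_(j < n)
    \int[lebesgue_measure]_t (f (x + t *: xi) i j * xi 0 i * zeta 0 j).

End Defs.

(* Main.v *)
Require Import Defs.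
From HB Require Import structures.
From mathcomp Require Import all_boot all_order all_algebra.
From mathcomp Require Import all_classical all_reals all_analysis.
From mathcomp Require Import measurable_realfun ring lra.
Import Order.TTheory GRing.Theory Num.Theory.
Import numFieldNormedType.Exports.
Local Open Scope classical_set_scope.
Local Open Scope ring_scope.

(** The proof compares two derivatives.  Fix a unit vector [xi], a vector
    [zeta] orthogonal to it and a point [x], and extend the zeroth moment
    [I^0 f (x, xi)] to all points [x] and all nonzero directions by the same
    formula, and the first moment [I^1 f (x, xi)] to all points [x].  Tilting
    the line in the zeroth moment differentiates [f] along [t *: zeta], and
    translating the line by [s *: zeta] in the first moment, which carries the
    weight [t], differentiates [f] along [zeta]; the resulting integrands
    agree at [s = 0], whence, at [s = 0],
      [d/ds I^0 f (x, xi + s zeta) =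
         d/ds I^1 f (x + s zeta, xi) + 2 * X^1 f (x, xi, zeta)].
    The last term comes from the two factors [xi_i], [xi_j] of the zeroth
    moment and from the symmetry of [f] ([is_derive_tensor_lineint0],
    [is_derive_tensor_lineint1]).

    In both directions of the equivalence the zeroth moment vanishes at all
    points and in all unit directions: either by moving the point along the
    line into the hyperplane orthogonal to [xi], or as the case [zeta = xi] of
    the elastic transform.  By homogeneity it vanishes in all nonzero
    directions, so the left-hand side is 0 ([tensor_lineint_derivatives]).  If
    the first moment vanishes too, then so does [X^1 f (x, xi, zeta)]; for
    [zeta] a multiple of [xi], the elastic transform is a multiple of the zeroth
    moment.  Conversely, if [X^1 f] vanishes, then
    [s |-> I^1 f (x + s zeta, xi)] has zero derivative, hence is constant; for
    [zeta] a unit vector it tends to 0 at infinity because [f] decays rapidly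
    ([lineint1_decay]), hence it is 0.  This needs some [zeta != 0] orthogonal
    to [xi], which is where [2 <= n] enters.

    Differentiation under the integral sign is justified by a bound that is
    uniform in [s]: since [zeta] is orthogonal to the unit vector [xi], the
    scalar product with [xi] of the point of parameter [t] on any of these
    lines is [dot x xi + t], so rapid decay of a function on the whole space
    gives a bound by a multiple of [1 / (1 + t ^ 2)] ([rapid_slab]). *)

(** * Integration on the real line *)

Section RealLine.
Set Implicit Arguments.
Unset Strict Implicit.
Context {R : realType}.
Notation mu := (@lebesgue_measure R).
Implicit Types (G : R -> R) (a b c t : R).

Lemma continuous_inv1Dsqr : continuous (fun t : R => (1 + t ^+ 2)^-1).
Proof.
move=> t; apply: cvgV.
  by rewrite gt_eqF// ltr_pwDl// sqr_ge0.
apply: cvgD; first exact: cvg_cst.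
exact: exprn_continuous.
Qed.

Lemma inv1Dsqr_ge0 t : 0 <= (1 + t ^+ 2)^-1.
Proof. by rewrite invr_ge0 addr_ge0// sqr_ge0. Qed.

Lemma integrable_inv1Dsqr :
  mu.-integrable setT (EFin \o (fun t : R => (1 + t ^+ 2)^-1)).
Proof.
have mf : measurable_fun setT (fun t : R => (1 + t ^+ 2)^-1).
  by apply: continuous_measurable_fun; exact: continuous_inv1Dsqr.
apply/integrableP; split; first exact/measurable_EFinP.
under eq_integral => t _ do rewrite /= ger0_norm ?inv1Dsqr_ge0//.
rewrite ge0_symfun_integralT//.
- rewrite -set_itvcy (@ge0_continuous_FTC2y _ _ atan 0 (pi / 2))//.
  + by rewrite -EFinB -EFinM ltry.
  + by move=> x _; exact: inv1Dsqr_ge0.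
  + exact/continuous_subspaceT/continuous_inv1Dsqr.
  + exact: cvgy_atan.
  + by apply: cvg_at_right_filter; exact: continuous_atan.
  + by move=> x _; rewrite derive1_atan.
- exact: inv1Dsqr_ge0.
- exact: continuous_inv1Dsqr.
- by move=> t; rewrite /= sqrrN.
Qed.

Lemma integrable_scale G c : mu.-integrable setT (EFin \o G) ->
  mu.-integrable setT (EFin \o (fun t => c * G t)).
Proof. by move=> iG; exact: (integrableZl measurableT c iG). Qed.

(** The integrability criterion behind every line integral below. *)
Lemma integrable_decay G c : continuous G ->
  (forall t, (1 + t ^+ 2) * `|G t| <= c) ->
  mu.-integrable setT (EFin \o G).
Proof.
move=> cG Gc.
apply: (@le_integrable _ _ _ mu setT measurableT _
  (EFin \o (fun t => c * (1 + t ^+ 2)^-1))).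
- by apply/measurable_EFinP; exact: continuous_measurable_fun.
- move=> t _; rewrite /= lee_fin (le_trans _ (ler_norm _))//.
  by rewrite ler_pdivlMr ?ltr_pwDl ?sqr_ge0// mulrC.
- exact/integrable_scale/integrable_inv1Dsqr.
Qed.

(** No integrability is assumed: the substitution is made separately in the
    positive and in the negative part. *)
Lemma Rintegral_affine G a b : 0 < a -> continuous G ->
  \int[mu]_t G t = \int[mu]_t (G (a * t + b) * a).
Proof.
move=> a0 cG; rewrite /Rintegral; congr fine.
have dF (x : R) : is_derive x (1 : R) (fun t : R => a * t + b) a.
  rewrite (_ : (fun t : R => a * t + b) = a \*: id + cst b); last exact/funext.
  apply: is_derive_eq.
  by rewrite addr0; exact: mulr1.
have dE : derive1 (fun t : R => a * t + b) = cst a.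
  by apply/funext => x; rewrite derive1E (@derive_val _ _ _ _ _ _ _ (dF x)).
have sub (H : R -> R) : continuous H -> (forall t, 0 <= H t) ->
    (\int[mu]_t (H t)%:E = \int[mu]_t (H (a * t + b) * a)%:E)%E.
  move=> cH H0.
  rewrite (@increasing_ge0_integration_by_substitutionT _ (fun t => a * t + b))//.
  - by apply: eq_integral => t _; rewrite dE.
  - by move=> x y xy; rewrite ltrD2r ltr_pM2l.
  - by rewrite dE; exact: cst_continuous.
  - by rewrite dE; exact: is_cvg_cst.
  - by rewrite dE; exact: is_cvg_cst.
  - exact: (cvg_comp _ _ (gt0_cvgMrNy a0 cvg_id) (cvg_addrr_Ny b)).
  - exact: (cvg_comp _ _ (gt0_cvgMry a0 cvg_id) (cvg_addrr b)).
rewrite [LHS]integralE [RHS]integralE; congr (_ - _)%E.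
- transitivity (\int[mu]_t (Num.max (G t) 0)%:E)%E.
    by apply: eq_integral => t _; rewrite funeposE EFin_max.
  rewrite sub//.
  + apply: eq_integral => t _.
    by rewrite funeposE -EFin_max maxr_pMl ?ltW// mul0r.
  + move=> t; apply: (@continuous_max _ _ G (cst 0)); first exact: cG.
    exact: cst_continuous.
  + by move=> t; rewrite le_max lexx orbT.
- transitivity (\int[mu]_t (Num.max (- G t) 0)%:E)%E.
    by apply: eq_integral => t _; rewrite funenegE -EFinN EFin_max.
  rewrite sub//.
  + apply: eq_integral => t _.
    by rewrite funenegE -EFinN -EFin_max maxr_pMl ?ltW// mul0r mulNr.
  + move=> t; apply: (@continuous_max _ _ (- G) (cst 0)).
      by apply: continuousN; exact: cG.
    exact: cst_continuous.
  + by move=> t; rewrite le_max lexx orbT.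
Qed.
End RealLine.

(** * The Euclidean scalar product *)

Section Dot.
Set Implicit Arguments.
Unset Strict Implicit.
Context {R : realType} {n : nat}.
Implicit Types (x y z : 'rV[R]_n) (a : R).

Lemma dotC x y : dot x y = dot y x.
Proof. by apply: eq_bigr => i _; rewrite mulrC. Qed.

Lemma dotDl x y z : dot (x + y) z = dot x z + dot y z.
Proof. by rewrite -big_split; apply: eq_bigr => i _; rewrite mxE mulrDl. Qed.

Lemma dotZl a x z : dot (a *: x) z = a * dot x z.
Proof. by rewrite mulr_sumr; apply: eq_bigr => i _; rewrite mxE mulrA. Qed.

Lemma dot0l x : dot 0 x = 0.
Proof. by rewrite -(scale0r 0) dotZl mul0r. Qed.

Lemma dotDr x y z : dot z (x + y) = dot z x + dot z y.
Proof. by rewrite !(dotC z) dotDl. Qed.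

Lemma dotZr a x z : dot z (a *: x) = a * dot z x.
Proof. by rewrite !(dotC z) dotZl. Qed.

Lemma coord_le_norm x i : `|x 0 i| <= `|x|.
Proof.
rewrite [leRHS]/Num.Def.normr/= mx_normrE.
by apply/bigmax_geP; right => /=; exists (0, i).
Qed.

Lemma dot_le_norm x y : `|dot x y| <= (\sum_i `|y 0 i|) * `|x|.
Proof.
rewrite (le_trans (ler_norm_sum _ _ _))// mulr_suml ler_sum// => i _.
by rewrite normrM mulrC ler_wpM2l// coord_le_norm.
Qed.

(** [dot y z] grows at most linearly in the norm of [y], so decay in the norm
    gives decay away from every slab [dot y z = c]. *)
Lemma slab_le_norm (z : 'rV[R]_n) (c : R) : exists2 M : R, 0 <= M &
  forall y, 1 + `|dot y z - c| <= M * (1 + `|y|).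
Proof.
have K0 : 0 <= \sum_i `|z 0 i| by exact: sumr_ge0.
exists (1 + `|c| + \sum_i `|z 0 i|); first by rewrite !addr_ge0.
move=> y; have y0 := normr_ge0 y; have c0 := normr_ge0 c.
have := dot_le_norm y z; have := ler_normB (dot y z) c.
set K := \sum_i _ in K0 *; nra.
Qed.

Lemma exists_orthogonal (x : 'rV[R]_n) : (1 < n)%N ->
  exists2 z : 'rV[R]_n, dot z x = 0 & dot z z = 1.
Proof.
move=> n1.
suff [w wx w0] : exists2 w : 'rV[R]_n, dot w x = 0 & 0 < dot w w.
  exists ((Num.sqrt (dot w w))^-1 *: w); first by rewrite dotZl wx mulr0.
  rewrite dotZl dotZr mulrA -expr2 exprVn sqr_sqrtr ?ltW//.
  by rewrite mulVf// gt_eqF.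
have dotd i y : dot (delta_mx 0 i) y = y 0 i :> R.
  rewrite /dot (bigD1 i)//= mxE !eqxx mul1r big1 ?addr0// => j ji.
  by rewrite mxE (negbTE ji) mul0r.
pose i : 'I_n := Ordinal (ltnW n1); pose j : 'I_n := Ordinal n1.
have [xi0|xi0] := eqVneq (x 0 i) 0.
  by exists (delta_mx 0 i); rewrite dotd// mxE !eqxx ltr01.
(* The first two coordinates of [x], rotated by a quarter turn. *)
exists (x 0 j *: delta_mx 0 i + (- x 0 i) *: delta_mx 0 j).
  by rewrite dotDl !dotZl !dotd mulNr mulrC subrr.
rewrite dotDl !dotZl !dotd !mxE !eqxx /= !mulr1 !mulr0 addr0 add0r.
by rewrite -!expr2 sqrrN ltr_wpDl ?sqr_ge0// lt_def sqr_ge0 sqrf_eq0 xi0.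
Qed.

End Dot.

(** * Rapidly decreasing functions *)

Section Rapid.
Set Implicit Arguments.
Unset Strict Implicit.
Context {R : realType} {n : nat}.
Implicit Types (x y z xi zeta : 'rV[R]_n) (g : 'rV[R]_n -> R).

(** Decay faster than any negative power of the norm; [1 + `|y|] is used so that
    one inequality covers both small and large [y]. *)
Definition rapid g := forall m : nat,
  exists C : R, forall y, (1 + `|y|) ^+ m * `|g y| <= C.

Lemma rapid_lincomb (I : finType) (c : I -> R) (g : I -> 'rV[R]_n -> R) :
  (forall i, rapid (g i)) -> rapid (fun y => \sum_i c i * g i y).
Proof.
move=> rg m; have /choice[C gC] : forall i, exists C : R,
  forall y, (1 + `|y|) ^+ m * `|g i y| <= C by move=> i; exact: rg.
exists (\sum_i `|c i| * C i) => y.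
have p0 : 0 <= (1 + `|y|) ^+ m by rewrite exprn_ge0// addr_ge0.
rewrite (le_trans (ler_wpM2l p0 (ler_norm_sum _ _ _)))//.
by rewrite mulr_sumr ler_sum// => i _; rewrite normrM mulrCA ler_wpM2l.
Qed.

(** The seminorms with monomial [1] or [x_i ^+ m] suffice, because the norm is the
    largest absolute value of a coordinate. *)
Lemma schwartz_rapid g s : schwartz g -> rapid (partials s g).
Proof.
move=> [_ gb] m.
have [C0 gC0] := gb (fun=> 0%N) s.
have /choice[C gC] : forall i : 'I_n, exists C : R,
    forall y, `|y 0 i| ^+ m * `|partials s g y| <= C.
  move=> i; have [C gC] := gb (fun j => if j == i then m else 0%N) s.
  exists C => y; rewrite -normrX -normrM (le_trans _ (gC y))//.
  rewrite /monom (bigD1 i)//= eqxx big1 ?mulr1// => j /negbTE ->.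
  exact: expr0.
exists (2 ^+ m * (C0 *+ 2 + \sum_i C i)) => y.
have {}gC0 : `|partials s g y| <= C0.
  by have := gC0 y; rewrite /monom big1 ?mul1r// => i _; exact: expr0.
have pow : (1 + `|y|) ^+ m <= 2 ^+ m * (1 + `|y| ^+ m).
  have [y1|y1] := leP `|y| 1.
    rewrite (@le_trans _ _ (2 ^+ m))//.
      by rewrite lerXn2r ?nnegrE ?addr_ge0//; lra.
    by rewrite ler_peMr ?exprn_ge0// lerDl exprn_ge0.
  rewrite (@le_trans _ _ ((2 * `|y|) ^+ m))//.
    by rewrite lerXn2r ?nnegrE ?addr_ge0 ?mulr_ge0//; lra.
  by rewrite exprMn ler_wpM2l ?exprn_ge0// lerDr.
have ypow : `|y| ^+ m <= 1 + \sum_i `|y 0 i| ^+ m.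
  have [/mx_norm_eq0 ->|/mx_norm_neq0[[i j]/= yij]] := eqVneq (mx_norm y) 0.
    rewrite normr0; apply: (@le_trans _ _ 1); last by rewrite lerDl sumr_ge0.
    by rewrite expr0n; case: (_ == _); rewrite ?ler01.
  rewrite [`|y|]yij (ord1 i) (bigD1 j)//= addrCA lerDl addr_ge0// sumr_ge0//.
have g0 := normr_ge0 (partials s g y).
rewrite (le_trans (ler_wpM2r g0 pow))// -mulrA ler_wpM2l ?exprn_ge0//.
apply: (@le_trans _ _ ((1 + (1 + \sum_i `|y 0 i| ^+ m)) * `|partials s g y|)).
  by rewrite ler_wpM2r// lerD2l.
rewrite !mulrDl !mul1r addrA mulr2n !lerD// mulr_suml.
by apply: ler_sum => i _; exact: gC.
Qed.

Lemma schwartz_differentiable g x : schwartz g -> differentiable g x.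
Proof. by move=> [/(_ [::])]. Qed.

Lemma derive_partials g zeta x : schwartz g ->
  'D_zeta g x = \sum_i zeta 0 i * partials [:: i] g x.
Proof.
move=> sg; have dg := schwartz_differentiable x sg.
rewrite deriveE// [X in 'd _ _ X]row_sum_delta linear_sum.
by apply: eq_bigr => i _; rewrite linearZ /= deriveE.
Qed.

Lemma rapid_derive g zeta : schwartz g -> rapid ('D_zeta g).
Proof.
move=> sg; rewrite (_ : 'D_zeta g = fun y => \sum_i zeta 0 i * partials [:: i] g y).
  by apply: rapid_lincomb => i; exact: schwartz_rapid.
by apply/funext => y; exact: derive_partials.
Qed.

(** Rapid decay in the scalar products with two vectors at once. *)
Lemma rapid_slab2 g xi zeta (c d : R) (m k : nat) : rapid g ->
  exists C : R, forall y,
  (1 + `|dot y xi - c|) ^+ m * (1 + `|dot y zeta - d|) ^+ k * `|g y| <= C.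
Proof.
move=> /(_ (m + k)%N)[C gC].
have [M M0 slabM] := slab_le_norm xi c; have [N N0 slabN] := slab_le_norm zeta d.
exists (M ^+ m * N ^+ k * C) => y.
have y0 : 0 <= 1 + `|y| by rewrite addr_ge0.
apply: (@le_trans _ _ (M ^+ m * N ^+ k * ((1 + `|y|) ^+ (m + k) * `|g y|))).
  rewrite exprD [leRHS]mulrA mulrACA -!exprMn ler_wpM2r//.
  by rewrite ler_pM ?exprn_ge0 ?addr_ge0// lerXn2r ?nnegrE ?addr_ge0// mulr_ge0.
by rewrite ler_wpM2l// mulr_ge0// exprn_ge0.
Qed.

(** The bound that makes line integrals converge: on a line along which
    [dot y xi = c + t], a rapidly decreasing [g] times [t ^+ q] is
    [O(1 / (1 + t ^+ 2))], with a constant that depends only on [g], [xi], [c]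
    and [q]. *)
Lemma rapid_slab g xi (c : R) (q : nat) : rapid g ->
  exists C : R, forall y t, dot y xi = c + t ->
    (1 + t ^+ 2) * `|t ^+ q * g y| <= C.
Proof.
move=> /(@rapid_slab2 _ xi 0 c 0 (q + 2) 0)[C gC].
exists C => y t yt; rewrite (le_trans _ (gC y))// expr0 mulr1.
rewrite yt (_ : c + t - c = t); last by rewrite addrAC subrr add0r.
rewrite normrM mulrA ler_wpM2r// exprD mulrC normrX.
rewrite ler_pM// ?addr_ge0 ?sqr_ge0 ?exprn_ge0//.
  by rewrite lerXn2r ?nnegrE ?addr_ge0// lerDr.
by rewrite -(real_normK (num_real t)); have := normr_ge0 t; nra.
Qed.
End Rapid.

(** * Line integrals depending on a parameter *)

Section LineIntegral.
Set Implicit Arguments.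
Unset Strict Implicit.
Context {R : realType} {n : nat}.
Notation mu := (@lebesgue_measure R).
Implicit Types (x y z xi zeta : 'rV[R]_n) (g : 'rV[R]_n -> R).

(** The point of parameter [t] on a line through [x] of direction [xi], moved
    along [zeta] by [s * t ^+ l]: for [l = 0] the line is translated by
    [s *: zeta], for [l = 1] its direction becomes [xi + s *: zeta]. *)
Definition sheared_line x xi zeta (l : nat) (s t : R) : 'rV[R]_n :=
  x + t *: xi + (s * t ^+ l) *: zeta.

Lemma dot_sheared_line x xi zeta l s t : dot xi xi = 1 -> dot zeta xi = 0 ->
  dot (sheared_line x xi zeta l s t) xi = dot x xi + t.
Proof.
by move=> xi1 zxi; rewrite !dotDl !dotZl xi1 zxi mulr1 mulr0 addr0.
Qed.

Lemma continuous_sheared_line x xi zeta l s :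
  continuous (sheared_line x xi zeta l s).
Proof.
move=> t; apply: cvgD; [apply: cvgD; first exact: cvg_cst|].
  by apply: cvgZr_tmp; exact: cvg_id.
apply: cvgZr_tmp; apply: cvgM; first exact: cvg_cst.
exact: exprn_continuous.
Qed.

Lemma continuous_line_integrand g x xi zeta q l s : schwartz g ->
  continuous (fun t : R => t ^+ q * g (sheared_line x xi zeta l s t)).
Proof.
move=> sg t; apply: cvgM; first exact: exprn_continuous.
apply: (@continuous_comp _ _ _ (sheared_line x xi zeta l s) g).
  exact: continuous_sheared_line.
exact/differentiable_continuous/schwartz_differentiable.
Qed.

Lemma integrable_line_integrand g x xi zeta q l s : schwartz g ->
  dot xi xi = 1 -> dot zeta xi = 0 ->
  mu.-integrable setT
    (EFin \o (fun t : R => t ^+ q * g (sheared_line x xi zeta l s t))).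
Proof.
move=> sg xi1 zxi.
have [C gC] := rapid_slab xi (dot x xi) q (schwartz_rapid [::] sg).
apply: (@integrable_decay _ _ C); first exact: continuous_line_integrand.
by move=> t; apply: gC; rewrite dot_sheared_line.
Qed.

Lemma is_derive_affine_comp g x z (s : R) : differentiable g (x + s *: z) ->
  is_derive s (1 : R) (fun s : R => g (x + s *: z)) ('D_z g (x + s *: z)).
Proof.
move=> dg; have dz : derivable g (x + s *: z) z by exact: diff_derivable.
have E : (fun h : R => h^-1 *: (((fun s : R => g (x + s *: z)) \o shift s) (h *: 1)
     - g (x + s *: z))) =
    (fun h : R => h^-1 *: ((g \o shift (x + s *: z)) (h *: z) - g (x + s *: z))).
  apply/funext => h /=; congr (_ *: (g _ - _)).
  by rewrite [_ *: 1]mulr1 scalerDl addrCA.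
by split; rewrite /derivable /derive E.
Qed.

(** Differentiation under the integral sign, for both kinds of motion of the
    line: each contributes a factor [t ^+ l] and a derivative along [zeta]. *)
Lemma is_derive_line_integral g x xi zeta k l (s : R) : schwartz g ->
  dot xi xi = 1 -> dot zeta xi = 0 ->
  is_derive s (1 : R)
    (fun s : R => \int[mu]_t (t ^+ k * g (sheared_line x xi zeta l s t)))
    (\int[mu]_t (t ^+ (k + l) * 'D_zeta g (sheared_line x xi zeta l s t))).
Proof.
move=> sg xi1 zxi.
have [C gC] := rapid_slab xi (dot x xi) (k + l) (rapid_derive zeta sg).
pose F (s t : R) : R := t ^+ k * g (sheared_line x xi zeta l s t).
have dF (s' t : R) : is_derive s' (1 : R) (F ^~ t)
    (t ^+ (k + l) * 'D_zeta g (sheared_line x xi zeta l s' t)).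
  have lineE r : x + t *: xi + r *: (t ^+ l *: zeta) = sheared_line x xi zeta l r t.
    by rewrite scalerA.
  have dg : is_derive s' (1 : R)
      (fun s' : R => g ((x + t *: xi) + s' *: (t ^+ l *: zeta)))
      ('D_(t ^+ l *: zeta) g ((x + t *: xi) + s' *: (t ^+ l *: zeta))).
    exact/is_derive_affine_comp/schwartz_differentiable.
  rewrite (_ : F ^~ t = t ^+ k \*: (fun s' : R =>
      g ((x + t *: xi) + s' *: (t ^+ l *: zeta)))).
    apply: is_derive_eq.
    rewrite exprD -mulrA; congr (_ * _); rewrite lineE.
    have dgx y := schwartz_differentiable y sg.
    by rewrite !deriveE// linearZ.
  by apply/funext => r; rewrite /F -lineE.
have FE s' t : partial1of2 F s' t =
    t ^+ (k + l) * 'D_zeta g (sheared_line x xi zeta l s' t).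
  by rewrite partial1of2E (@derive_val _ _ _ _ _ _ _ (dF s' t)).
pose G (t : R) : R := C * (1 + t ^+ 2)^-1.
have FG s' t : `|partial1of2 F s' t| <= G t.
  rewrite FE /G ler_pdivlMr ?ltr_pwDl ?sqr_ge0// mulrC.
  by apply: gC; rewrite dot_sheared_line.
have G0 t : 0 <= G t by exact: le_trans (FG 0 t).
have iG : mu.-integrable setT (EFin \o G).
  exact/integrable_scale/integrable_inv1Dsqr.
(* Any neighbourhood of [s] would do, as the bound [G] is uniform in [s]. *)
have sI : `]s - 1, s + 1[%classic s by rewrite /= in_itv/= ltrBlDr !ltrDl ltr01.
have iF s' : `]s - 1, s + 1[%classic s' -> mu.-integrable setT (EFin \o F s').
  by move=> _; exact: integrable_line_integrand.
have dF' s' t : `]s - 1, s + 1[%classic s' -> setT t -> derivable (F ^~ t) s' 1.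
  by move=> _ _; exact: ex_derive.
have FG' s' t : `]s - 1, s + 1[%classic s' -> setT t ->
    `|partial1of2 F s' t| <= G t by [].
split; first exact: (derivable_under_integral measurableT sI iF dF' G0 iG FG').
rewrite -derive1E.
rewrite (differentiation_under_integral measurableT sI iF dF' G0 iG FG').
by apply: eq_Rintegral => t _; rewrite FE.
Qed.
End LineIntegral.

(** * Moments of a function along a line *)

Section Lineint.
Set Implicit Arguments.
Unset Strict Implicit.
Context {R : realType} {n : nat}.
Notation mu := (@lebesgue_measure R).
Implicit Types (x y z xi zeta : 'rV[R]_n) (g : 'rV[R]_n -> R).

(** The [q]-th moment of [g] along the line through [x] of direction [xi]; the
    parameter is [t], not arc length, and [xi] need not be a unit vector. *)
Definition lineint (q : nat) g x xi : R := \int[mu]_t (t ^+ q * g (x + t *: xi)).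

Lemma sheared_line0 x xi zeta l t : sheared_line x xi zeta l 0 t = x + t *: xi.
Proof. by rewrite /sheared_line mul0r scale0r addr0. Qed.

Lemma sheared_line_pt x xi zeta s t :
  sheared_line x xi zeta 0 s t = (x + s *: zeta) + t *: xi.
Proof. by rewrite /sheared_line expr0 mulr1 addrAC. Qed.

Lemma sheared_line_dir x xi zeta s t :
  sheared_line x xi zeta 1 s t = x + t *: (xi + s *: zeta).
Proof. by rewrite /sheared_line expr1 mulrC scalerDr scalerA addrA. Qed.

Lemma continuous_lineint g x xi q : schwartz g ->
  continuous (fun t : R => t ^+ q * g (x + t *: xi)).
Proof.
move=> /(@continuous_line_integrand _ _ g x xi 0 q 0 0).
by under eq_fun do rewrite sheared_line0.
Qed.

Lemma integrable_lineint g x xi q : schwartz g -> dot xi xi = 1 ->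
  mu.-integrable setT (EFin \o (fun t : R => t ^+ q * g (x + t *: xi))).
Proof.
move=> sg xi1.
have := integrable_line_integrand x q 0 0 sg xi1 (dot0l xi).
rewrite (_ : (fun t : R => t ^+ q * g (sheared_line x xi 0 0 0 t)) =
  (fun t : R => t ^+ q * g (x + t *: xi)))//.
by apply/funext => t; rewrite sheared_line0.
Qed.

Lemma lineint_scale g x xi (a : R) : schwartz g -> dot xi xi = 1 -> 0 < a ->
  lineint 0 g x (a *: xi) = a^-1 * lineint 0 g x xi.
Proof.
move=> sg xi1 a0; rewrite mulrC /lineint -RintegralZr//; last first.
  exact: integrable_lineint.
have ai : 0 < a^-1 by rewrite invr_gt0.
rewrite (Rintegral_affine 0 ai (@continuous_lineint g x (a *: xi) 0 sg)).
apply: eq_Rintegral => t _; rewrite addr0 !expr0 scalerA [_ * t * a]mulrAC mulVf ?mul1r//.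
by rewrite gt_eqF.
Qed.

Lemma lineint_translate q g x xi (c : R) : schwartz g ->
  lineint q g (x + c *: xi) xi =
  \int[mu]_t ((t - c) ^+ q * g (x + t *: xi)).
Proof.
move=> sg; rewrite /lineint.
rewrite (Rintegral_affine (- c) ltr01 (@continuous_lineint g _ xi q sg)).
apply: eq_Rintegral => t _; rewrite mul1r mulr1 -addrA -scalerDl.
by rewrite [c + _]addrC subrK.
Qed.

Lemma lineint0_translate g x xi (c : R) : schwartz g ->
  lineint 0 g (x + c *: xi) xi = lineint 0 g x xi.
Proof. by move=> sg; rewrite lineint_translate. Qed.

Lemma lineint1_translate g x xi (c : R) : schwartz g -> dot xi xi = 1 ->
  lineint 1 g (x + c *: xi) xi = lineint 1 g x xi - c * lineint 0 g x xi.
Proof.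
move=> sg xi1; rewrite lineint_translate// /lineint.
rewrite -RintegralZl -?RintegralB//; try exact: integrable_lineint.
- by apply: eq_Rintegral => t _; rewrite !expr1 expr0 mul1r mulrBl.
- exact/integrable_scale/integrable_lineint.
Qed.

(** Tilting the line in the zeroth moment gives the same derivative as translating
    it in the first moment, which is [is_derive_lineint_pt] at [s = 0]. *)
Lemma is_derive_lineint_dir g x xi zeta : schwartz g ->
  dot xi xi = 1 -> dot zeta xi = 0 ->
  is_derive (0 : R) (1 : R) (fun s : R => lineint 0 g x (xi + s *: zeta))
    (lineint 1 ('D_zeta g) x xi).
Proof.
move=> sg xi1 zxi.
have := is_derive_line_integral x 0 1 0 sg xi1 zxi.
rewrite add0n.
under [X in is_derive _ _ X _]eq_fun do under eq_Rintegral do rewrite sheared_line_dir.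
by under [X in is_derive _ _ _ X]eq_Rintegral do rewrite sheared_line0.
Qed.

Lemma is_derive_lineint_pt g x xi zeta (s : R) : schwartz g ->
  dot xi xi = 1 -> dot zeta xi = 0 ->
  is_derive s (1 : R) (fun s : R => lineint 1 g (x + s *: zeta) xi)
    (lineint 1 ('D_zeta g) (x + s *: zeta) xi).
Proof.
move=> sg xi1 zxi.
have := is_derive_line_integral x 1 0 s sg xi1 zxi.
rewrite addn0.
under [X in is_derive _ _ X _]eq_fun do under eq_Rintegral do rewrite sheared_line_pt.
by under [X in is_derive _ _ _ X]eq_Rintegral do rewrite sheared_line_pt.
Qed.

(** The first moment tends to 0 as the line is moved to infinity orthogonally
    to its direction. *)
Lemma lineint1_decay g x xi zeta : schwartz g ->
  dot xi xi = 1 -> dot zeta xi = 0 -> dot zeta zeta = 1 ->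
  exists K : R, forall s : R,
    (1 + `|s|) * `|lineint 1 g (x + s *: zeta) xi| <= K.
Proof.
move=> sg xi1 zxi z1.
(* Of the three powers of [1 + `|t|], one absorbs the weight [t] and two make
   the bound integrable; the power of [1 + `|s|] gives the decay. *)
have [C gC] := rapid_slab2 xi zeta (dot x xi) (dot x zeta) 3 1
  (schwartz_rapid [::] sg).
exists (\int[mu]_t (C * (1 + t ^+ 2)^-1)) => s.
have s0 : 0 <= 1 + `|s| by rewrite addr_ge0.
pose G (t : R) := (1 + `|s|) * (t ^+ 1 * g (x + s *: zeta + t *: xi)).
have iG : mu.-integrable setT (EFin \o G).
  exact/integrable_scale/integrable_lineint.
rewrite -[X in X * _](ger0_norm s0) -normrM -RintegralZl//; last first.
  exact: integrable_lineint.
apply: le_trans (le_normr_Rintegral measurableT iG) _.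
apply: le_Rintegral => //.
- exact: integrable_norm iG.
- exact/integrable_scale/integrable_inv1Dsqr.
- move=> t _; rewrite ler_pdivlMr ?ltr_pwDl ?sqr_ge0//.
  apply: le_trans (gC (x + s *: zeta + t *: xi)).
  rewrite !dotDl !dotZl xi1 zxi z1 (dotC xi) zxi.
  rewrite !mulr0 !mulr1 !addr0 addrAC subrr add0r.
  rewrite (_ : dot x zeta + s - dot x zeta = s); last by rewrite addrAC subrr add0r.
  rewrite /G !normrM (ger0_norm s0) !expr1.
  rewrite [leLHS](_ : _ = (`|t| * (1 + t ^+ 2)) * ((1 + `|s|) *
    `|g (x + s *: zeta + t *: xi)|)); last by ring.
  rewrite -[leRHS]mulrA ler_wpM2r// ?mulr_ge0//.
  by rewrite -(real_normK (num_real t)); have := normr_ge0 t; nra.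
Qed.

End Lineint.

(** * Symmetric tensor fields *)

Section Tensor.
Set Implicit Arguments.
Unset Strict Implicit.
Context {R : realType} {n : nat}.
Implicit Types (x y z u v xi zeta : 'rV[R]_n) (f : 'rV[R]_n -> 'M[R]_n).

(** The [q]-th moment of [f] along the line through [x] of direction [xi],
    contracted with [u] and [v].  Keeping the direction and the two contracted
    vectors separate covers the moments ([u = v = xi]) and the elastic ray
    transform ([u = xi], [v = zeta]) at once. *)
Definition tensor_lineint q f x xi u v : R :=
  \sum_(i < n) \sum_(j < n) lineint q (fun y => f y i j) x xi * u 0 i * v 0 j.

Lemma momentE q f x xi : schwartz_sym2 f -> dot xi xi = 1 ->
  moment q f x xi = tensor_lineint q f x xi xi xi.
Proof.
move=> [_ sf] xi1; apply: eq_bigr => i _; apply: eq_bigr => j _.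
have int_f := integrable_lineint x q (sf i j) xi1.
rewrite -mulrA -RintegralZr//.
by apply: eq_Rintegral => t _; rewrite mulrA.
Qed.

Lemma elastic_ray1E f x xi zeta : schwartz_sym2 f -> dot xi xi = 1 ->
  elastic_ray1 f x xi zeta = tensor_lineint 0 f x xi xi zeta.
Proof.
move=> [_ sf] xi1; apply: eq_bigr => i _; apply: eq_bigr => j _.
have int_f := integrable_lineint x 0 (sf i j) xi1.
rewrite -mulrA -RintegralZr//.
by apply: eq_Rintegral => t _; rewrite expr0 mul1r mulrA.
Qed.

Lemma tensor_lineintZr q f x xi u v (a : R) :
  tensor_lineint q f x xi u (a *: v) = a * tensor_lineint q f x xi u v.
Proof.
rewrite mulr_sumr; apply: eq_bigr => i _; rewrite mulr_sumr.
by apply: eq_bigr => j _; rewrite mxE mulrCA.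
Qed.

Lemma tensor_lineint_sym q f x xi u v : schwartz_sym2 f ->
  tensor_lineint q f x xi u v = tensor_lineint q f x xi v u.
Proof.
move=> [fT _]; rewrite /tensor_lineint exchange_big.
apply: eq_bigr => i _; apply: eq_bigr => j _; rewrite mulrAC; congr (_ * _ * _).
by congr lineint; apply/funext => y; rewrite -{1}fT mxE.
Qed.

Lemma tensor_lineint0_homogeneous f x xi (a : R) : schwartz_sym2 f ->
  dot xi xi = 1 -> 0 < a ->
  tensor_lineint 0 f x (a *: xi) (a *: xi) (a *: xi) =
  a * tensor_lineint 0 f x xi xi xi.
Proof.
move=> [_ sf] xi1 a0; rewrite mulr_sumr; apply: eq_bigr => i _.
rewrite mulr_sumr; apply: eq_bigr => j _; rewrite lineint_scale// !mxE.
by field; rewrite gt_eqF.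
Qed.

Lemma tensor_lineint0_translate f x xi (c : R) : schwartz_sym2 f ->
  tensor_lineint 0 f (x + c *: xi) xi xi xi = tensor_lineint 0 f x xi xi xi.
Proof.
move=> [_ sf]; apply: eq_bigr => i _; apply: eq_bigr => j _.
by rewrite lineint0_translate.
Qed.

Lemma tensor_lineint1_translate f x xi (c : R) : schwartz_sym2 f ->
  dot xi xi = 1 ->
  tensor_lineint 1 f (x + c *: xi) xi xi xi =
  tensor_lineint 1 f x xi xi xi - c * tensor_lineint 0 f x xi xi xi.
Proof.
move=> [_ sf] xi1; rewrite mulr_sumr -sumrB; apply: eq_bigr => i _.
rewrite mulr_sumr -sumrB; apply: eq_bigr => j _.
by rewrite lineint1_translate//; ring.
Qed.

(** The first moment along a line of the derivative of [f] in direction [zeta],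
    contracted twice with the direction [xi] of the line. *)
Definition tensor_lineint_derive f zeta x xi : R :=
  \sum_(i < n) \sum_(j < n)
    lineint 1 ('D_zeta (fun y => f y i j)) x xi * xi 0 i * xi 0 j.

Lemma is_derive_sum2 (F : 'I_n -> 'I_n -> R -> R) (dF : 'I_n -> 'I_n -> R) (s : R) :
  (forall i j, is_derive s (1 : R) (F i j) (dF i j)) ->
  is_derive s (1 : R) (fun s : R => \sum_i \sum_j F i j s) (\sum_i \sum_j dF i j).
Proof.
move=> FdF; rewrite (_ : (fun _ => _) = \sum_i \sum_j F i j); last first.
  by apply/funext => r; rewrite fct_sumE; apply: eq_bigr => i _; rewrite fct_sumE.
by apply: is_derive_sum => i; exact: is_derive_sum.
Qed.

Lemma is_derive_tensor_lineint1 f x xi zeta (s : R) : schwartz_sym2 f ->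
  dot xi xi = 1 -> dot zeta xi = 0 ->
  is_derive s (1 : R) (fun s : R => tensor_lineint 1 f (x + s *: zeta) xi xi xi)
    (tensor_lineint_derive f zeta (x + s *: zeta) xi).
Proof.
move=> [_ sf] xi1 zxi; apply: is_derive_sum2 => i j.
have := is_derive_lineint_pt x s (sf i j) xi1 zxi.
set L := fun _ : R => _ => dL.
rewrite (_ : (fun _ => _) = (xi 0 i * xi 0 j) \*: L).
  by apply: is_derive_eq; rewrite [LHS]mulrC mulrA.
by apply/funext => r /=; rewrite -mulrA [LHS]mulrC.
Qed.

Lemma is_derive_tensor_lineint0 f x xi zeta : schwartz_sym2 f ->
  dot xi xi = 1 -> dot zeta xi = 0 ->
  is_derive (0 : R) (1 : R) (fun s : R => let v := xi + s *: zeta in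
      tensor_lineint 0 f x v v v)
    (tensor_lineint_derive f zeta x xi + 2 * tensor_lineint 0 f x xi xi zeta).
Proof.
move=> sf xi1 zxi.
have -> : tensor_lineint_derive f zeta x xi + 2 * tensor_lineint 0 f x xi xi zeta =
    \sum_i \sum_j (lineint 1 ('D_zeta (fun y => f y i j)) x xi * xi 0 i * xi 0 j
     + (lineint 0 (fun y => f y i j) x xi * zeta 0 i * xi 0 j
     + lineint 0 (fun y => f y i j) x xi * xi 0 i * zeta 0 j)).
  rewrite mulr_natl mulr2n {1}tensor_lineint_sym// -!big_split/=.
  by apply: eq_bigr => i _; rewrite -!big_split.
case: sf => _ sf; apply: is_derive_sum2 => i j.
have := is_derive_lineint_dir x (sf i j) xi1 zxi.
set L := fun _ : R => _ => dL.
have da k : is_derive (0 : R) (1 : R) (cst (xi 0 k) + zeta 0 k \*: id) (zeta 0 k).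
  by apply: is_derive_eq; rewrite add0r [LHS]mulr1.
rewrite (_ : (fun _ => _) =
  L * (cst (xi 0 i) + zeta 0 i \*: id) * (cst (xi 0 j) + zeta 0 j \*: id)).
  apply: is_derive_eq.
  rewrite /L /= ?fctE /= scale0r !scaler0 !addr0 /GRing.scale/=.
  by ring.
apply/funext => s; rewrite /= !mxE (mulrC s (zeta 0 i)) (mulrC s (zeta 0 j)).
by [].
Qed.

(** If the zeroth moment vanishes identically, then so does its derivative when
    the direction is tilted; the tilted direction is not a unit vector, which
    homogeneity takes care of. *)
Lemma tensor_lineint_derivatives f x xi zeta : schwartz_sym2 f ->
  dot xi xi = 1 -> dot zeta xi = 0 ->
  (forall y u, dot u u = 1 -> tensor_lineint 0 f y u u u = 0) ->
  tensor_lineint_derive f zeta x xi + 2 * tensor_lineint 0 f x xi xi zeta = 0.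
Proof.
move=> sf xi1 zxi T0.
have := is_derive_tensor_lineint0 x sf xi1 zxi.
rewrite (_ : (fun _ => _) = cst 0).
  by move=> dT; rewrite -(@derive_val _ _ _ _ _ _ _ dT) derive_cst.
apply/funext => s /=; set v := xi + s *: zeta.
have v0 : 0 < dot v v.
  rewrite /v !(dotDl, dotDr, dotZl, dotZr) xi1 zxi (dotC xi) zxi !mulr0.
  rewrite addr0 add0r mulrA -expr2 ltr_pwDl// mulr_ge0 ?sqr_ge0//.
  by rewrite sumr_ge0// => i _; rewrite -expr2 sqr_ge0.
pose r := Num.sqrt (dot v v); have r0 : 0 < r by rewrite sqrtr_gt0.
have e1 : dot (r^-1 *: v) (r^-1 *: v) = 1.
  rewrite dotZl dotZr mulrA -expr2 exprVn sqr_sqrtr ?ltW//.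
  by rewrite mulVf// gt_eqF.
have -> : v = r *: (r^-1 *: v) by rewrite scalerA mulfV ?gt_eqF// scale1r.
by rewrite tensor_lineint0_homogeneous// T0// mulr0.
Qed.

Lemma moments_eq0_elastic_eq0 f : schwartz_sym2 f ->
  (forall x xi, TS (x, xi) -> moment 0 f x xi = 0) ->
  (forall x xi, TS (x, xi) -> moment 1 f x xi = 0) ->
  forall x xi zeta, ZZ (xi, zeta) -> elastic_ray1 f x xi zeta = 0.
Proof.
move=> sf m0 m1.
have TSproj x xi : dot xi xi = 1 -> TS (x - dot x xi *: xi, xi).
  by move=> xi1; split=> //=; rewrite -scaleNr dotDl dotZl xi1 mulr1 subrr.
have T0 x xi : dot xi xi = 1 -> tensor_lineint 0 f x xi xi xi = 0.
  move=> xi1; rewrite -(subrK (dot x xi *: xi) x) tensor_lineint0_translate//.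
  by rewrite -momentE// m0//; exact: TSproj.
have T1 x xi : dot xi xi = 1 -> tensor_lineint 1 f x xi xi xi = 0.
  move=> xi1; rewrite -(subrK (dot x xi *: xi) x) tensor_lineint1_translate//.
  by rewrite T0// mulr0 subr0 -momentE// m1//; exact: TSproj.
move=> x xi zeta [/= xi1 xz]; rewrite elastic_ray1E//.
have [[c ->]|zxi] := xz; first by rewrite tensor_lineintZr T0// mulr0.
have := tensor_lineint_derivatives x sf xi1 zxi T0.
have dT1 := is_derive_tensor_lineint1 x 0 sf xi1 zxi.
rewrite (_ : (fun _ => _) = cst 0) in dT1; last first.
  by apply/funext => s; exact: T1.
move: (@derive_val _ _ _ _ _ _ _ dT1); rewrite derive_cst scale0r addr0 => <-.
by rewrite add0r; move/eqP; rewrite mulf_eq0 pnatr_eq0 => /eqP.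
Qed.

Lemma elastic_eq0_moments_eq0 f : (1 < n)%N -> schwartz_sym2 f ->
  (forall x xi zeta, ZZ (xi, zeta) -> elastic_ray1 f x xi zeta = 0) ->
  forall x xi, dot xi xi = 1 -> moment 0 f x xi = 0 /\ moment 1 f x xi = 0.
Proof.
move=> n1 sf r0.
have T0 x xi : dot xi xi = 1 -> tensor_lineint 0 f x xi xi xi = 0.
  move=> xi1; rewrite -elastic_ray1E// r0//; split=> //; left.
  by exists 1; rewrite scale1r.
move=> x xi xi1; rewrite !momentE// T0//; split=> //.
have [zeta zxi z1] := exists_orthogonal xi n1.
have D0 y : tensor_lineint_derive f zeta y xi = 0.
  have := tensor_lineint_derivatives y sf xi1 zxi T0.
  rewrite -elastic_ray1E// r0 ?mulr0 ?addr0//.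
  by split=> //; right.
pose h (s : R) := tensor_lineint 1 f (x + s *: zeta) xi xi xi.
have h_cst s : h s = h 0.
  apply: is_derive_0_is_cst => r; rewrite -(D0 (x + r *: zeta)).
  exact: is_derive_tensor_lineint1.
have [K hK] : exists K : R, forall s : R, (1 + `|s|) * `|h s| <= K.
  have [_ sfij] := sf.
  have /choice[K gK] : forall ij : 'I_n * 'I_n, exists K : R, forall s : R,
      (1 + `|s|) * `|lineint 1 (fun y => f y ij.1 ij.2) (x + s *: zeta) xi| <= K.
    by move=> ij; exact: lineint1_decay.
  exists (\sum_i \sum_j K (i, j) * `|xi 0 i * xi 0 j|) => s.
  have s0 : 0 <= 1 + `|s| by rewrite addr_ge0.
  rewrite -[X in X * _](ger0_norm s0) -normrM mulr_sumr.
  rewrite (le_trans (ler_norm_sum _ _ _))// ler_sum// => i _.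
  rewrite mulr_sumr (le_trans (ler_norm_sum _ _ _))// ler_sum// => j _.
  rewrite -[X in _ * X]mulrA [X in `|X|]mulrA normrM ler_wpM2r// normrM (ger0_norm s0).
  exact: (gK (i, j)).
(* As [h] is constant and [(1 + `|s|) * `|h s|] is bounded by [K], it is zero:
   test at [s = K / `|h 0|]. *)
have h0 : h 0 = 0.
  apply/eqP; apply/negPn/negP => h0.
  have := hK (K / `|h 0|); rewrite h_cst => /le_gtF/negbT/negP; apply.
  have h0p : 0 < `|h 0| by rewrite normr_gt0.
  rewrite mulrDl mul1r normf_div normr_id divfK ?gt_eqF//.
  by rewrite ltr_pwDl// ler_norm.
by rewrite -h0 /h scale0r addr0.
Qed.

End Tensor.

Theorem proposition13 (R : realType) (n : nat) (hn : (2 <= n)%N) :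
  [set f : 'rV[R]_n -> 'M[R]_n |
    [/\ schwartz_sym2 f,
        (forall x xi : 'rV[R]_n, TS (x, xi) -> moment 0 f x xi = 0) &
        (forall x xi : 'rV[R]_n, TS (x, xi) -> moment 1 f x xi = 0)]] =
  [set f : 'rV[R]_n -> 'M[R]_n |
    schwartz_sym2 f /\
    (forall x xi zeta : 'rV[R]_n,
       ZZ (xi, zeta) -> elastic_ray1 f x xi zeta = 0)].
Proof.
apply/seteqP; split=> f /=.
  by move=> [sf m0 m1]; split=> //; exact: moments_eq0_elastic_eq0.
move=> [sf r0]; split=> // x xi [xi1 _].
- exact: (elastic_eq0_moments_eq0 hn sf r0 x xi1).1.
- exact: (elastic_eq0_moments_eq0 hn sf r0 x xi1).2.
Qed.
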